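(* Let $N\ge1$ be an integer, $\mathcal X=\{0,1,\dots,N\}$, $a,b,c>0$, and let $$K(x,y)=\sum_{z=\max(x,y)}^{N}\pi(x,z,c,a)\,\pi(z-y,N-y,a,b)\qquad(x,y\in\mathcal X),$$ where $\pi$ is the Hahn measure. Then $K(x,y)\ge0$, $\sum_{x\in\mathcal X}K(x,y)=1$, and with $\lambda=(c,a+b)$ one has, for all $x,y,n\in\mathcal X$, $$K(x,y)\,\pi(y,N,\lambda)=K(y,x)\,\pi(x,N,\lambda),$$ $$\sum_{y\in\mathcal X}K(x,y)\,\pi(y,N,\lambda)\,\check P_n(y,\lambda)=\kappa(n)\,\pi(x,N,\lambda)\,\check P_n(x,\lambda),$$ with $$\kappa(n)=\sum_{k=0}^n\frac{(-n)_k(n+a+b+c-1)_k(a)_k}{(a+b)_k(a+c)_k\,k!}=\frac{(b)_n(c)_n}{(a+b)_n(a+c)_n}.$$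
   Context: $(a)_n=a(a+1)\cdots(a+n-1)$. Hahn measure ($a,b>0$, integers $0\le x\le M$): $\pi(x,M,a,b)=\binom Mx\frac{(a)_x(b)_{M-x}}{(a+b)_M}$. Hahn polynomials on $\mathcal X$: $\check P_n(x,a,b)=\sum_{k=0}^n\frac{(-n)_k(n+a+b-1)_k(-x)_k}{(a)_k(-N)_k\,k!}$. *)

(* Defs.v *)
(* Only ordered-field arithmetic occurs, so the reals are replaced by an
   arbitrary realFieldType. *)
From mathcomp Require Import all_boot all_order all_algebra.

Set Implicit Arguments.
Unset Strict Implicit.
Unset Printing Implicit Defensive.

Import Order.TTheory GRing.Theory Num.Theory.
Local Open Scope ring_scope.

(* (a)_n = a (a + 1) ... (a + n - 1), with (a)_0 = 1. *)
Definition poch (R : realFieldType) (a : R) (n : nat) : R :=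
  \prod_(i < n) (a + i%:R).

(* pi(x, M, a, b), meant for x <= M: the subtraction M - x is that of nat. *)
Definition hahn_measure (R : realFieldType) (x M : nat) (a b : R) : R :=
  'C(M, x)%:R * (poch a x * poch b (M - x)%N / poch (a + b) M).

(* The polynomial of degree n for the measure on {0, ..., N}, meant for n <= N,
   so that the denominators (- N)_k do not vanish. *)
Definition hahn_poly (R : realFieldType) (N n x : nat) (a b : R) : R :=
  \sum_(k < n.+1)
    poch (- n%:R) k * poch (n%:R + a + b - 1) k * poch (- x%:R) k
    / (poch a k * poch (- N%:R) k * k`!%:R).

(* The nat subtractions z - y and N - y are exact, since y <= z <= N. *)
Definition hahn_kernel (R : realFieldType) (N : nat) (a b c : R) (x y : nat) : R :=
  \sum_(maxn x y <= z < N.+1)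
    hahn_measure x z c a * hahn_measure (z - y)%N (N - y)%N a b.

Definition hahn_kappa (R : realFieldType) (a b c : R) (n : nat) : R :=
  \sum_(k < n.+1)
    poch (- n%:R) k * poch (n%:R + a + b + c - 1) k * poch a k
    / (poch (a + b) k * poch (a + c) k * k`!%:R).

(* Main.v *)
(* Detailed balance holds because K(x,y) pi(y,N,c,a+b) is the symmetric sum
   over z of pi(z,N,a+c,b) pi(x,z,c,a) pi(y,z,c,a): K is the composition of
   the transition z -> y with kernel pi(.,z,c,a) and its adjoint.  By the
   factorial moments of the Hahn measure, the first transition maps the Hahn
   polynomial with parameters (c, a+b) to the one with (a+c, b).  The adjoint
   is a transition of the same kind after the reflection x -> N - x.  This
   reflection multiplies a Hahn polynomial by a quotient of Pochhammer symbols,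
   and the two reflections produce kappa(n).  The same reflection formula,
   applied to a 3F2 that degenerates to a 2F1, is the Pfaff-Saalschutz sum. *)
Require Import Defs.
From mathcomp Require Import all_boot all_order all_algebra.
From mathcomp Require Import ring zify.

Set Implicit Arguments.
Unset Strict Implicit.
Unset Printing Implicit Defensive.

Import Order.TTheory GRing.Theory Num.Theory.
Local Open Scope ring_scope.

(** * Pochhammer symbols and Vandermonde convolutions *)

Section Pochhammer.
Variable R : realFieldType.
Implicit Types (a b c v w : R) (k m n : nat).

Lemma poch0 a : poch a 0 = 1.
Proof. by rewrite /poch big_ord0. Qed.

Lemma pochSr a n : poch a n.+1 = poch a n * (a + n%:R).
Proof. by rewrite /poch big_ord_recr. Qed.

Lemma pochD a m n : poch a (m + n) = poch a m * poch (a + m%:R) n.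
Proof.
elim: n => [|n IHn]; first by rewrite addn0 poch0 mulr1.
by rewrite addnS !pochSr IHn natrD addrA mulrA.
Qed.

Lemma pochS a n : poch a n.+1 = a * poch (a + 1) n.
Proof. by rewrite -add1n pochD pochSr poch0 mul1r addr0. Qed.

Lemma poch_gt0 a n : 0 < a -> 0 < poch a n.
Proof. by move=> a_gt0; apply: prodr_gt0 => i _; rewrite ltr_wpDr ?ler0n. Qed.

Lemma poch_neq0 a n : 0 < a -> poch a n != 0.
Proof. by move=> a_gt0; rewrite gt_eqF ?poch_gt0. Qed.

Lemma poch_reflect a n : poch (1 - a - n%:R) n = (-1) ^+ n * poch a n.
Proof.
elim: n a => [|n IHn] a; first by rewrite !poch0 mulr1.
have -> : 1 - a - n.+1%:R = 1 - (a + 1) - n%:R by rewrite -natr1; ring.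
by rewrite pochSr IHn (pochS a) exprS; ring.
Qed.

Lemma poch_opp_nat n k : poch (- n%:R) k = (-1) ^+ k * (n ^_ k)%:R :> R.
Proof.
elim: k => [|k IHk]; first by rewrite poch0 ffactn0 mulr1.
rewrite pochSr IHk ffactnSr natrM exprS.
case: (leqP k n) => [le_kn | lt_nk]; first by rewrite natrB //; ring.
by rewrite ffact_small // !(mulr0, mul0r).
Qed.

Lemma poch_opp_nat_neq0 n k : (k <= n)%N -> poch (- n%:R) k != 0 :> R.
Proof.
move=> le_kn; rewrite poch_opp_nat mulf_neq0 ?signr_eq0 //.
by rewrite pnatr_eq0 -lt0n ffact_gt0.
Qed.

Lemma poch_opp_nat_fact n k :
  poch (- n%:R) k / k`!%:R = (-1) ^+ k * 'C(n, k)%:R :> R.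
Proof.
rewrite poch_opp_nat -bin_ffact natrM mulrA mulfK //.
by rewrite pnatr_eq0 -lt0n fact_gt0.
Qed.

(** Induction on [n] for all [a], [b] at once: the first factor [a + b] splits the right side as
    Pascal's rule splits the left. *)
Lemma poch_vandermonde a b n :
  \sum_(i < n.+1) 'C(n, i)%:R * (poch a i * poch b (n - i)) = poch (a + b) n.
Proof.
elim: n a b => [|n IHn] a b.
  by rewrite big_ord_recl big_ord0 /= !poch0 bin0 !mulr1 addr0.
rewrite pochS (_ : (a + b) * _ = a * poch (a + 1 + b) n + b * poch (a + (b + 1)) n);
  last by rewrite mulrDl; congr (_ * poch _ _ + _ * poch _ _); ring.
rewrite -!IHn !mulr_sumr.
rewrite big_ord_recl [X in _ = _ + X]big_ord_recl /= !bin0 !subn0.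
rewrite (pochS b) poch0 !mul1r.
under eq_bigr => i _ do rewrite binS natrD mulrDl subSS.
rewrite big_split /= big_ord_recr /= bin_small // mul0r addr0.
rewrite addrA addrC; congr (_ + (_ + _)); apply: eq_bigr => -[i lt_in] _.
  by rewrite pochS; ring.
by rewrite /= -(subnSK lt_in) (pochS b) /bump /=; ring.
Qed.

(* The Vandermonde sum at [b := 1 - v - n], with the reflections undone. *)
Lemma poch_sub v w n :
  \sum_(i < n.+1) (-1) ^+ i * 'C(n, i)%:R * (poch w i * poch (v + i%:R) (n - i))
  = poch (v - w) n.
Proof.
have e1 : w + (1 - v - n%:R) = 1 - (v - w) - n%:R by ring.
have := poch_vandermonde w (1 - v - n%:R) n.
rewrite e1 poch_reflect => /(congr1 ( *%R ((-1) ^+ n))).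
rewrite signrMK => <-; rewrite mulr_sumr; apply: eq_bigr => -[i /=].
rewrite ltnS => le_in _.
have -> : 1 - v - n%:R = 1 - (v + i%:R) - (n - i)%:R by rewrite natrB //; ring.
have sgnD : (-1) ^+ n = (-1) ^+ (n - i) * (-1) ^+ i :> R by rewrite -exprD subnK.
by rewrite poch_reflect -[LHS](signrMK (n - i)) sgnD; ring.
Qed.

(** Factorial moments of the unnormalized Hahn weights. Absorption, (x+1) C(m+1,x+1) = (m+1) C(m,x),
    lowers [m] and [k] by one and raises [c] by one. For [k > m] both sides vanish, so the truncated
    [m - k] is harmless. *)
Lemma poch_vandermonde_opp_nat a c m k :
  \sum_(x < m.+1) 'C(m, x)%:R * (poch c x * poch a (m - x)) * poch (- x%:R) k
  = poch (- m%:R) k * poch c k * poch (c + a + k%:R) (m - k).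
Proof.
elim: k m c => [|k IHk] m c.
  under eq_bigr => i _ do rewrite poch0 mulr1.
  by rewrite poch_vandermonde !poch0 !mul1r addr0 subn0.
case: m => [|m]; first by rewrite big_ord1 (pochS (- 0%:R)) oppr0 !mul0r mulr0.
rewrite big_ord_recl /= (pochS (- 0%:R)) oppr0 !mul0r mulr0 add0r.
have -> : c + a + k.+1%:R = c + 1 + a + k%:R by rewrite -natr1; ring.
rewrite subSS !pochS.
have -> : - m.+1%:R + 1 = - m%:R :> R by rewrite -natr1; ring.
rewrite [RHS](_ : _ = - m.+1%:R * c *
  (poch (- m%:R) k * poch (c + 1) k * poch (c + 1 + a + k%:R) (m - k))); last by ring.
rewrite -IHk mulr_sumr; apply: eq_bigr => i _; rewrite /bump /= add1n subSS !pochS.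
have -> : - i.+1%:R + 1 = - i%:R :> R by rewrite -natr1; ring.
have /(congr1 (fun j => j%:R : R)) := mul_bin_diag m.+1 i.
rewrite /= !natrM => E.
rewrite [LHS](_ : _ = - (i.+1%:R * 'C(m.+1, i.+1)%:R) *
   (c * poch (c + 1) i * poch a (m - i) * poch (- i%:R) k)); last by ring.
by rewrite -E; ring.
Qed.

End Pochhammer.

(** * Terminating hypergeometric sums at argument 1 *)

Section Hypergeometric.
Variable R : realFieldType.
Implicit Types (al be v w A : R).

(* 3F2(-n, A, w; be, v; 1) *)
Definition hyper3F2 n A w be v : R :=
  \sum_(k < n.+1)
    poch (- n%:R) k * poch A k * poch w k / (poch be k * poch v k * k`!%:R).

(** This is [poch_sub] at [v = be], [w = A], divided by [poch be n]. *)
Lemma chu_vandermonde n A be : (forall k, (k <= n)%N -> poch be k != 0) ->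
  \sum_(k < n.+1) poch (- n%:R) k * poch A k / (poch be k * k`!%:R)
  = poch (be - A) n / poch be n.
Proof.
move=> be0; rewrite -poch_sub mulr_suml; apply: eq_bigr => -[k /=].
rewrite ltnS => le_kn _.
have beD : poch be n = poch be k * poch (be + k%:R) (n - k).
  by rewrite -pochD subnKC.
have := be0 n (leqnn n); rewrite -poch_opp_nat_fact beD mulf_eq0 negb_or.
have f0 : k`!%:R != 0 :> R by rewrite pnatr_eq0 -lt0n fact_gt0.
by case/andP => *; field; apply/and3P.
Qed.

(* Expand [poch (v - w) k / poch v k] in the [poch w j / poch v j] and sum the
   coefficient of each by Chu-Vandermonde. *)
Lemma hyper3F2_reflect n al be v w :
    (forall k, (k <= n)%N -> poch al k != 0) ->
    (forall k, (k <= n)%N -> poch be k != 0) ->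
    (forall k, (k <= n)%N -> poch v k != 0) ->
  hyper3F2 n (n%:R + al + be - 1) (v - w) be v
  = (-1) ^+ n * (poch al n / poch be n)
    * hyper3F2 n (n%:R + al + be - 1) w al v.
Proof.
move=> al0 be0 v0; set A := n%:R + al + be - 1.
(* Since C(k,j) = 0 for j > k, the triangular double sum can be written over a square and its order
   exchanged. *)
pose G k j : R := poch (- n%:R) k * poch A k / (poch be k * k`!%:R) *
   ((-1) ^+ j * 'C(k, j)%:R * (poch w j / poch v j)).
transitivity (\sum_(k < n.+1) \sum_(j < n.+1) G k j).
  apply: eq_bigr => -[k /=]; rewrite ltnS => le_kn _.
  rewrite [LHS](_ : _ = poch (- n%:R) k * poch A k / (poch be k * k`!%:R) *
    (poch (v - w) k / poch v k)); last by rewrite !invfM; ring.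
  rewrite -mulr_sumr; congr (_ * _).
  rewrite -poch_sub mulr_suml (big_ord_widen _ (fun i => (-1) ^+ i * 'C(k, i)%:R
    * (poch w i * poch (v + i%:R) (k - i)) / poch v k) (le_kn : (k.+1 <= n.+1)%N)).
  rewrite big_mkcond /=; apply: eq_bigr => j _; rewrite ltnS.
  case: leqP => [le_jk | lt_kj]; last by rewrite bin_small // mulr0 mul0r.
  have vD : poch v k = poch v j * poch (v + j%:R) (k - j) by rewrite -pochD subnKC.
  have := v0 k le_kn; rewrite vD mulf_eq0 negb_or.
  by case/andP => *; field; apply/andP.
rewrite exchange_big /= mulr_sumr; apply: eq_bigr => -[j /=].
rewrite ltnS => le_jn _.
rewrite -(big_mkord xpredT (fun k => G k j)) (@big_cat_nat _ _ _ j) ?leqW //=.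
rewrite big1_seq ?add0r; last first.
  move=> k /andP[_]; rewrite mem_index_iota => /andP[_ lt_kj].
  by rewrite /G bin_small // !(mul0r, mulr0).
rewrite -{1}(add0n j) big_addn big_mkord subSn //.
(* With k = j + i the inner sum is a 2F1 with upper parameters -(n-j), A+j and lower parameter be+j;
   [H] collects the factors free of i. *)
pose H := poch (- n%:R) j * poch A j / (poch be j * j`!%:R) * (-1) ^+ j *
  (poch w j / poch v j).
have fact0 k : k`!%:R != 0 :> R by rewrite pnatr_eq0 -lt0n fact_gt0.
have be0' k : (k <= n - j)%N -> poch be j != 0 /\ poch (be + j%:R) k != 0.
  move=> le_k; have : poch be (j + k) != 0 by apply: be0; lia.
  by rewrite pochD mulf_eq0 negb_or => /andP[].
transitivity (H * \sum_(i < (n - j).+1) poch (- (n - j)%:R) i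
    * poch (A + j%:R) i / (poch (be + j%:R) i * i`!%:R)).
  rewrite mulr_sumr; apply: eq_bigr => -[i /=]; rewrite ltnS => le_i _.
  have [bj bi] := be0' i le_i.
  rewrite /G addnC !pochD.
  have -> : - n%:R + j%:R = - (n - j)%:R :> R by rewrite natrB //; ring.
  have /(congr1 (fun m => m%:R : R)) := bin_fact (leq_addr i j).
  rewrite addKn !natrM => <-.
  have b0 : 'C(j + i, j)%:R != 0 :> R by rewrite pnatr_eq0 -lt0n bin_gt0 leq_addr.
  have vj := v0 j le_jn.
  by rewrite /H; field; rewrite ?b0 ?fact0 ?bj ?bi ?vj.
rewrite chu_vandermonde => [|k le_k]; last by have [] := be0' k le_k.
(* Here the form of [A] matters: up to sign, the Chu-Vandermonde numerator becomes
   [poch (al + j%:R) (n - j)], which is how [al] enters. *)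
have -> : be + j%:R - (A + j%:R) = 1 - (al + j%:R) - (n - j)%:R.
  by rewrite /A natrB //; ring.
rewrite poch_reflect /H.
have [bj bi] := be0' (n - j)%N (leqnn _).
have vj := v0 j le_jn; have aj := al0 j le_jn.
have sgnD : (-1) ^+ n = (-1) ^+ j * (-1) ^+ (n - j) :> R by rewrite -exprD subnKC.
have nD d : poch d n = poch d j * poch (d + j%:R) (n - j) :> R.
  by rewrite -pochD subnKC.
rewrite sgnD !nD.
by field; rewrite ?fact0 ?bj ?bi ?vj ?aj.
Qed.

Lemma pfaff_saalschutz n (a b c : R) : 0 < a -> 0 < b -> 0 < c ->
  hyper3F2 n (n%:R + a + b + c - 1) a (a + b) (a + c)
  = poch b n * poch c n / (poch (a + b) n * poch (a + c) n).
Proof.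
move=> a0 b0 c0; have ab0 := addr_gt0 a0 b0; have ac0 := addr_gt0 a0 c0.
(* Reflect with [al = w = c], [be = a + b], [v = a + c]: the upper and lower parameters [c] then
   cancel, leaving a 2F1. *)
have -> : n%:R + a + b + c - 1 = n%:R + c + (a + b) - 1 by ring.
rewrite [X in hyper3F2 _ _ X](_ : a = a + c - c); last by rewrite addrK.
rewrite hyper3F2_reflect => [|k _|k _|k _]; try exact: poch_neq0.
rewrite /hyper3F2.
under eq_bigr => k _.
  rewrite (_ : _ / _ = poch (- n%:R) k * poch (n%:R + c + (a + b) - 1) k
    / (poch (a + c) k * k`!%:R)); first by over.
  have := poch_neq0 k c0 => c0k; have := poch_neq0 k ac0 => ac0k.
  by field; rewrite ac0k c0k pnatr_eq0 -lt0n fact_gt0.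
rewrite chu_vandermonde => [|k _]; last exact: poch_neq0.
have -> : a + c - (n%:R + c + (a + b) - 1) = 1 - b - n%:R by ring.
rewrite poch_reflect !invfM -[RHS](signrMK n); ring.
Qed.

End Hypergeometric.

(** * The Hahn measure: moments and the urn decomposition *)

Section HahnMeasure.
Variable R : realFieldType.
Implicit Types (a b c v A : R).

Lemma hahn_measure_ge0 x M a b : 0 < a -> 0 < b -> 0 <= hahn_measure x M a b.
Proof.
move=> a0 b0; have ab0 := addr_gt0 a0 b0.
by rewrite mulr_ge0 // divr_ge0 ?mulr_ge0 // ltW ?poch_gt0.
Qed.

Lemma hahn_measure_neq0 x M a b : (x <= M)%N -> 0 < a -> 0 < b ->
  hahn_measure x M a b != 0.
Proof.
move=> le_xM a0 b0; have ab0 := addr_gt0 a0 b0.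
rewrite !mulf_neq0 ?invr_eq0 ?poch_neq0 //.
by rewrite pnatr_eq0 -lt0n bin_gt0.
Qed.

Lemma hahn_measure_small x M a b : (M < x)%N -> hahn_measure x M a b = 0.
Proof. by move=> lt_Mx; rewrite /hahn_measure bin_small // mul0r. Qed.

Lemma hahn_measure_rev x M a b : (x <= M)%N ->
  hahn_measure (M - x) M b a = hahn_measure x M a b.
Proof.
move=> le_xM.
by rewrite /hahn_measure bin_sub // subKn // (addrC b) (mulrC (poch b _)).
Qed.

(** Gives sums over [0, z] a range independent of z, so that they can be exchanged with the sum over
    z. *)
Lemma sum_hahn_measure_widen M m a b (f : nat -> R) : (m <= M)%N ->
  \sum_(x < M.+1) hahn_measure x m a b * f x
  = \sum_(x < m.+1) hahn_measure x m a b * f x.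
Proof.
move=> le_mM; rewrite [RHS](big_ord_widen _
  (fun x => hahn_measure x m a b * f x) (le_mM : (m.+1 <= M.+1)%N)).
rewrite [RHS]big_mkcond; apply: eq_bigr => x _; rewrite ltnS.
by case: leqP => // ?; rewrite hahn_measure_small ?mul0r.
Qed.

Lemma hahn_measure_moment m k a b : 0 < a -> 0 < b ->
  \sum_(x < m.+1) hahn_measure x m a b * poch (- x%:R) k
  = poch (- m%:R) k * (poch a k / poch (a + b) k).
Proof.
move=> a0 b0; have ab0 := addr_gt0 a0 b0.
rewrite -[RHS](mulfK (poch_neq0 m ab0)).
(* For [k > m] both sides are zero because (-m)_k is. *)
have -> : poch (- m%:R) k * (poch a k / poch (a + b) k) * poch (a + b) m
    = poch (- m%:R) k * poch a k * poch (a + b + k%:R) (m - k).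
  case: (leqP k m) => [le_km | lt_mk]; last first.
    by rewrite poch_opp_nat ffact_small // !(mulr0, mul0r).
  have -> : poch (a + b) m = poch (a + b) k * poch (a + b + k%:R) (m - k).
    by rewrite -pochD subnKC.
  by field; apply: poch_neq0.
rewrite -poch_vandermonde_opp_nat mulr_suml.
by apply: eq_bigr => x _; rewrite /hahn_measure; ring.
Qed.

Lemma sum_hahn_measure m a b : 0 < a -> 0 < b ->
  \sum_(x < m.+1) hahn_measure x m a b = 1.
Proof.
move=> a0 b0; have := hahn_measure_moment m 0 a0 b0.
under eq_bigr => x _ do rewrite poch0 mulr1.
by rewrite !poch0 !mul1r invr1.
Qed.

(** Termwise: the factor (a)_k of the k-th factorial moment cancels the lower parameter [a], and its
    denominator puts [a + b] there. The parameter [v] is free, so it can stay at -N while [m]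
    varies. *)
Lemma sum_hahn_measure_hyper3F2 m n A a b v : 0 < a -> 0 < b ->
  \sum_(x < m.+1) hahn_measure x m a b * hyper3F2 n A (- x%:R) a v
  = hyper3F2 n A (- m%:R) (a + b) v.
Proof.
move=> a0 b0; have ab0 := addr_gt0 a0 b0.
under eq_bigr => x _ do rewrite mulr_sumr.
rewrite exchange_big; apply: eq_bigr => k _ /=.
pose D := poch (- n%:R) k * poch A k / (poch a k * poch v k * k`!%:R).
transitivity (D * \sum_(x < m.+1) hahn_measure x m a b * poch (- x%:R) k).
  by rewrite mulr_sumr; apply: eq_bigr => x _; rewrite /D; ring.
rewrite hahn_measure_moment // /D !invfM.
by rewrite -[RHS](mulfK (poch_neq0 k a0)); ring.
Qed.

(* Both sides are the law of a three-block Polya urn: cut [0, N] at [z] and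
   then [0, z] at [x], or cut at [x] first. *)
Lemma hahn_measure_chain x z N a b c :
    (x <= z)%N -> (z <= N)%N -> 0 < a -> 0 < b -> 0 < c ->
  hahn_measure z N (a + c) b * hahn_measure x z c a
  = hahn_measure x N c (a + b) * hahn_measure (N - z) (N - x) b a.
Proof.
move=> le_xz le_zN a0 b0 c0.
have ab0 := addr_gt0 a0 b0; have ac0 := addr_gt0 a0 c0.
have abc0 := addr_gt0 ab0 c0; have le_xN := leq_trans le_xz le_zN.
(* Both products are the trinomial coefficient N! / (x! (z-x)! (N-z)!). *)
have binE : ('C(N, z) * 'C(z, x) = 'C(N, x) * 'C(N - x, N - z))%N.
  have E : (N - x - (N - z) = z - x)%N by lia.
  have leE : (N - z <= N - x)%N by lia.
  apply/eqP; rewrite -(eqn_pmul2r (fact_gt0 x)) -(eqn_pmul2r (fact_gt0 (z - x))).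
  rewrite -(eqn_pmul2r (fact_gt0 (N - z))); apply/eqP.
  transitivity N`!.
    by rewrite -(bin_fact le_zN) -(bin_fact le_xz); ring.
  by rewrite -(bin_fact le_xN) -(bin_fact leE) E; ring.
rewrite /hahn_measure [(N - x - _)%N](_ : _ = z - x)%N; last lia.
have /(congr1 (fun m => m%:R : R)) := binE; rewrite !natrM => binR.
rewrite [LHS](_ : _ = ('C(N, z)%:R * 'C(z, x)%:R) * (poch c x * poch b (N - z) *
  poch a (z - x) / poch (a + b + c) N)); last first.
  rewrite (addrC c a) (addrAC a c b).
  by field; rewrite !poch_neq0.
rewrite binR (addrC b a) (addrC c (a + b)).
by field; rewrite !poch_neq0.
Qed.

(** The adjoint transition: given x, the variable i = N - z has a Hahn law on [0, N-x]. Terms with z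
    < x vanish on both sides. *)
Lemma sum_hahn_measure_chain x N a b c (g : nat -> R) :
    (x <= N)%N -> 0 < a -> 0 < b -> 0 < c ->
  \sum_(z < N.+1) hahn_measure z N (a + c) b * (hahn_measure x z c a * g z)
  = hahn_measure x N c (a + b)
    * \sum_(i < (N - x).+1) hahn_measure i (N - x) b a * g (N - i)%N.
Proof.
move=> le_xN a0 b0 c0.
rewrite -(sum_hahn_measure_widen b a (fun i => g (N - i)%N) (leq_subr x N)).
rewrite (reindex_inj rev_ord_inj) mulr_sumr; apply: eq_bigr => -[i /=].
rewrite ltnS subSS => le_iN _; rewrite mulrA.
case: (leqP x (N - i)) => [le_x | lt_x].
  by rewrite hahn_measure_chain ?leq_subr // subKn // mulrA.
rewrite (hahn_measure_small _ _ lt_x) (@hahn_measure_small i); last lia.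
by rewrite !(mulr0, mul0r).
Qed.

(** * Reversibility and spectrum of the kernel *)

Lemma hahn_kernel_detailed N x y a b c :
    (y <= N)%N -> 0 < a -> 0 < b -> 0 < c ->
  hahn_kernel N a b c x y * hahn_measure y N c (a + b)
  = \sum_(z < N.+1) hahn_measure z N (a + c) b
      * (hahn_measure x z c a * hahn_measure y z c a).
Proof.
move=> le_yN a0 b0 c0; rewrite /hahn_kernel big_geq_mkord big_mkcond /= mulr_suml.
apply: eq_bigr => -[z /=]; rewrite ltnS geq_max => le_zN _.
case: (leqP x z) => [le_xz | lt_zx] /=; last first.
  by rewrite (hahn_measure_small _ _ lt_zx) !(mulr0, mul0r).
case: (leqP y z) => [le_yz | lt_zy]; last first.
  by rewrite (hahn_measure_small _ _ lt_zy) !(mulr0, mul0r).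
(* The urn identity at [y] moves the weight of [y] inside; reversing the second block matches the
   kernel's factor. *)
rewrite [RHS]mulrCA hahn_measure_chain // -mulrA; congr (_ * _).
have le' : (z - y <= N - y)%N by rewrite leq_sub2r.
rewrite -(hahn_measure_rev _ _ le') mulrC; congr (_ * hahn_measure _ _ _ _); lia.
Qed.

Lemma sum_hahn_kernel N y a b c : (y <= N)%N -> 0 < a -> 0 < b -> 0 < c ->
  \sum_(x < N.+1) hahn_kernel N a b c x y = 1.
Proof.
move=> le_yN a0 b0 c0; have ab0 := addr_gt0 a0 b0.
(* Multiplying by the nonzero weight of [y] gives access to the symmetric form, where x and then z
   can be summed out. *)
apply: (mulIf (hahn_measure_neq0 le_yN c0 ab0)); rewrite mul1r mulr_suml.
under eq_bigr => x _ do rewrite hahn_kernel_detailed //.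
rewrite exchange_big /=.
have sum1 (z : 'I_N.+1) : \sum_(x < N.+1) hahn_measure x z c a = 1.
  under eq_bigr => x _ do rewrite -[hahn_measure _ _ _ _]mulr1.
  rewrite (sum_hahn_measure_widen c a (fun=> 1) (ltn_ord z : (z <= N)%N)).
  by under eq_bigr => x _ do rewrite mulr1; rewrite sum_hahn_measure.
under eq_bigr => z _.
  rewrite -mulr_sumr -mulr_suml sum1 mul1r -[hahn_measure y z c a]mulr1.
  by over.
rewrite (sum_hahn_measure_chain (fun=> 1)) //.
by under eq_bigr => i _ do rewrite mulr1; rewrite sum_hahn_measure ?mulr1.
Qed.

Lemma hahn_kernel_eigen N x n a b c :
    (x <= N)%N -> (n <= N)%N -> 0 < a -> 0 < b -> 0 < c ->
  \sum_(y < N.+1) hahn_kernel N a b c x y * hahn_measure y N c (a + b)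
                  * hahn_poly N n y c (a + b)
  = poch b n * poch c n / (poch (a + b) n * poch (a + c) n)
    * hahn_measure x N c (a + b) * hahn_poly N n x c (a + b).
Proof.
move=> le_xN le_nN a0 b0 c0.
have ab0 := addr_gt0 a0 b0; have ac0 := addr_gt0 a0 c0.
set A := n%:R + c + (a + b) - 1; set v : R := - N%:R.
have v0 k : (k <= n)%N -> poch v k != 0.
  by move=> le_kn; rewrite poch_opp_nat_neq0 // (leq_trans le_kn).
have p0 d k : 0 < d -> (k <= n)%N -> poch d k != 0 by move=> *; apply: poch_neq0.
(* First transition: averaging over y given z raises the lower parameter [c] to [a + c]. *)
transitivity (\sum_(z < N.+1) hahn_measure z N (a + c) b * (hahn_measure x z c a
    * hyper3F2 n A (- z%:R) (a + c) v)).
  under eq_bigr => y _ do rewrite hahn_kernel_detailed ?mulr_suml -1?ltnS //.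
  rewrite exchange_big; apply: eq_bigr => z _ /=.
  rewrite (addrC a c) -sum_hahn_measure_hyper3F2 //.
  rewrite -(sum_hahn_measure_widen c a (fun y => hyper3F2 n A (- y%:R) c v)
    (ltn_ord z : (z <= N)%N)).
  rewrite !mulr_sumr; apply: eq_bigr => y _.
  by rewrite -!mulrA.
rewrite (sum_hahn_measure_chain (fun z => hyper3F2 n A (- z%:R) (a + c) v)) //.
(* Reflect z = N - i with [al = b], [be = a + c], then average over i, which raises [b] to
   [b + a]. *)
transitivity (hahn_measure x N c (a + b) *
    ((-1) ^+ n * (poch b n / poch (a + c) n) * hyper3F2 n A (- (N - x)%:R) (b + a) v)).
  congr (_ * _); rewrite -sum_hahn_measure_hyper3F2 // mulr_sumr.
  apply: eq_bigr => -[i /=]; rewrite ltnS => le_i _.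
  have -> : - (N - i)%:R = v - - i%:R :> R by rewrite natrB /v; [ring | lia].
  have -> : A = n%:R + b + (a + c) - 1 by rewrite /A; ring.
  by rewrite hyper3F2_reflect //; [ring | move=> *; exact: p0 ..].
(* The second reflection, with [al = c], [be = a + b], returns from N - x to x; the two signs
   cancel. *)
have -> : - (N - x)%:R = v - - x%:R :> R by rewrite natrB // /v; ring.
rewrite (addrC b a) hyper3F2_reflect //; try by move=> *; exact: p0.
rewrite [hahn_poly N n x c (a + b)](_ : _ = hyper3F2 n A (- x%:R) c v) //.
rewrite !invfM -[RHS](signrMK n); ring.
Qed.

End HahnMeasure.

Theorem mainTheorem14 (R : realFieldType) (N : nat) (hN : (1 <= N)%N)
    (a b c : R) (ha : 0 < a) (hb : 0 < b) (hc : 0 < c) :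
  [/\ forall x y : 'I_N.+1, 0 <= hahn_kernel N a b c x y,
      forall y : 'I_N.+1, \sum_(x < N.+1) hahn_kernel N a b c x y = 1,
      forall x y : 'I_N.+1,
        hahn_kernel N a b c x y * hahn_measure y N c (a + b)
        = hahn_kernel N a b c y x * hahn_measure x N c (a + b),
      forall x n : 'I_N.+1,
        \sum_(y < N.+1) hahn_kernel N a b c x y * hahn_measure y N c (a + b)
                        * hahn_poly N n y c (a + b)
        = hahn_kappa a b c n * hahn_measure x N c (a + b)
          * hahn_poly N n x c (a + b)
    & forall n : 'I_N.+1,
        hahn_kappa a b c n
        = poch b n * poch c n / (poch (a + b) n * poch (a + c) n)].
Proof.
have leN (x : 'I_N.+1) : (x <= N)%N by rewrite -ltnS.
split=> [x y | y | x y | x n | n].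
- by apply: sumr_ge0 => z _; rewrite mulr_ge0 ?hahn_measure_ge0.
- exact: sum_hahn_kernel.
- rewrite !hahn_kernel_detailed //; apply: eq_bigr => z _.
  by rewrite (mulrC (hahn_measure x z c a)).
(* [hahn_kappa] unfolds to exactly the 3F2 summed by [pfaff_saalschutz]. *)
- by rewrite hahn_kernel_eigen // -pfaff_saalschutz.
- exact: pfaff_saalschutz.
Qed.
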